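(* Let $N\ge 2$ and let $T:\mathcal{M}_N\to\mathcal{M}_N$ be a bistochastic channel such that $\hat T$ is strictly contractive with rate $C\in[0,1)$. Then: (i) $\hat T$ is ergodic, i.e. $X\in\mathcal{M}_N$ satisfies $\hat T(X)=X$ if and only if $X=\chi\mathbf{1}$ for some $\chi\in\mathbb{C}$; (ii) the spectrum of the operator $T\hat T=T\circ\hat T$ on $\mathcal{M}_N$ is contained in $[0,1-\gamma]\cup\{1\}$ for some $\gamma\ge 1-C$, i.e. every eigenvalue of $T\hat T$ other than $1$ lies in $[0,C]$; (iii) for every density matrix $\sigma\in\mathcal{D}_N$, $$S[\hat T(\sigma)]-S(\sigma)\ \ge\ \frac{1-C}{2}\,\big\|\sigma-N^{-1}\mathbf{1}\big\|_2^2 .$$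
   Context: $\mathcal{M}_N$ is the algebra of $N\times N$ complex matrices, $\mathbf{1}$ the identity matrix, $\mathcal{D}_N$ the set of $N\times N$ density matrices (positive semidefinite, trace one). A channel is a linear map $T:\mathcal{M}_N\to\mathcal{M}_N$ (Heisenberg picture) that is unital ($T(\mathbf{1})=\mathbf{1}$) and completely positive. Its Schrödinger-picture dual $\hat T$ is defined by $\mathrm{tr}[\hat T(A)B]=\mathrm{tr}[A\,T(B)]$ for all $A,B\in\mathcal{M}_N$; $\hat T$ is completely positive and trace preserving. $T$ is bistochastic if $T(\mathbf{1})=\hat T(\mathbf{1})=\mathbf{1}$. $\hat T$ is strictly contractive with rate $C\in[0,1)$ if $\|\hat T(\sigma)-\hat T(\sigma')\|_1\le C\|\sigma-\sigma'\|_1$ for all $\sigma,\sigma'\in\mathcal{D}_N$, where $\|A\|_1=\mathrm{tr}(A^*A)^{1/2}$ is the trace norm. $\|A\|_2=[\mathrm{tr}(A^*A)]^{1/2}$ is the Hilbert–Schmidt norm, and $S(\sigma)=-\mathrm{tr}(\sigma\ln\sigma)$ is the von Neumann entropy. $T\hat T$ is regarded as a linear operator on $\mathcal{M}_N$ equipped with the Hilbert–Schmidt inner product $\langle A,B\rangle=\mathrm{tr}(A^*B)$. *)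

(* Defs.v *)
From HB Require Import structures.
From mathcomp Require Import all_boot all_order all_algebra.
From mathcomp Require Import all_classical all_reals exp.
From mathcomp Require Import complex.
Set Implicit Arguments. Unset Strict Implicit. Unset Printing Implicit Defensive.
Import Order.TTheory GRing.Theory Num.Theory.
Local Open Scope ring_scope.
Local Open Scope complex_scope.

Section QDefs.
Variable R : realType.
Local Notation C := R[i].

Definition adjmx m n (A : 'M[C]_(m, n)) : 'M[C]_(n, m) := (map_mx conjc A)^T.

Definition unitarymx n (U : 'M[C]_n) : Prop := U *m adjmx U = 1%:M.

(* positive semidefinite "matrix" indexed by an arbitrary finite type:
   x^* A x >= 0 (order of C: real and nonnegative) for all vectors x *)
Definition psdf (I : finType) (A : I -> I -> C) : Prop :=
  forall x : I -> C, 0 <= \sum_(i : I) \sum_(j : I) (x i)^* * A i j * x j.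

Definition psd n (A : 'M[C]_n) : Prop := psdf (fun i j => A i j).

Definition density n (s : 'M[C]_n) : Prop := psd s /\ \tr s = 1.

(* complete positivity: for every k, id_k (x) T maps positive elements of
   M_k(M_n) (indexed by 'I_k * 'I_n) to positive elements *)
Definition completely_positive n (T : 'M[C]_n -> 'M[C]_n) : Prop :=
  forall (k : nat) (A : 'I_k * 'I_n -> 'I_k * 'I_n -> C),
    psdf A ->
    psdf (fun p q => T (\matrix_(i, j) A (p.1, i) (q.1, j)) p.2 q.2).

(* functional calculus f(A) = U diag(f(d)) U^* for A = U diag(d) U^*,
   U unitary, d real (well defined for Hermitian A) *)
Definition mxfun n (f : R -> R) (A : 'M[C]_n) : 'M[C]_n :=
  xget 0 [set B | exists (U : 'M[C]_n) (d : 'I_n -> R),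
     [/\ unitarymx U,
         A = U *m diag_mx (\row_i (d i)%:C) *m adjmx U &
         B = U *m diag_mx (\row_i (f (d i))%:C) *m adjmx U]].

Definition trnorm n (A : 'M[C]_n) : R :=
  complex.Re (\tr (mxfun Num.sqrt (adjmx A *m A))).

Definition hsnorm n (A : 'M[C]_n) : R :=
  Num.sqrt (complex.Re (\tr (adjmx A *m A))).

(* von Neumann entropy S(s) = - tr (s ln s), with 0 ln 0 = 0 *)
Definition entropy n (s : 'M[C]_n) : R :=
  - complex.Re (\tr (mxfun (fun x => x * ln x) s)).

End QDefs.

(* Main.v *)
(* Let A = V diag(d) V^* and F A = U diag(e) U^* for a positive, unital, trace
   preserving map F.  Then e = Q d, where Q i j = tr (F (v_j v_j^* ) u_i u_i^* )
   is doubly stochastic.  Two consequences follow: F contracts the trace norm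
   of Hermitian matrices, and, since x ln x - x^2 / 2 is convex on [0, 1],
   S (F s) - S s >= (|s|_2^2 - |F s|_2^2) / 2 for a density s.
     On traceless Hermitian matrices Th contracts the trace norm with rate C,
   hence so does K = T Th, which is self-adjoint and nonnegative for the
   Hilbert-Schmidt product.  The sequence |K^m X|_2 is log-convex and is
   dominated by C^m |X|_1, so |K X|_2 <= C |X|_2, and therefore
   |Th X|_2^2 = <X, K X> <= C |X|_2^2.  This bounds the eigenvalues of K and,
   applied to X = s - 1/N, turns the entropy inequality above into (iii). *)
Require Import Defs.
From HB Require Import structures.
From mathcomp Require Import all_boot all_order all_algebra.
From mathcomp Require Import all_classical all_reals exp.
From mathcomp Require Import topology subspace_topology normedtype derive realfun.
From mathcomp Require Import complex ring lra.
Import Order.TTheory GRing.Theory Num.Theory.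
Import numFieldNormedType.Exports.
Local Open Scope ring_scope.
Local Open Scope complex_scope.
Set Implicit Arguments.
Unset Strict Implicit.
Unset Printing Implicit Defensive.

(** * Adjoints and positive semidefinite matrices *)

Section Adjoint.
Variable R : realType.
Local Notation C := R[i].

Lemma adjmxK m n (A : 'M[C]_(m, n)) : adjmx (adjmx A) = A.
Proof. by apply/matrixP => i j; rewrite !mxE conjcK. Qed.

Lemma adjmxM m n p (A : 'M[C]_(m, n)) (B : 'M[C]_(n, p)) :
  adjmx (A *m B) = adjmx B *m adjmx A.
Proof. by rewrite /adjmx map_mxM trmx_mul. Qed.

Lemma adjmxD m n (A B : 'M[C]_(m, n)) : adjmx (A + B) = adjmx A + adjmx B.
Proof. by rewrite /adjmx map_mxD linearD. Qed.

Lemma adjmxB m n (A B : 'M[C]_(m, n)) : adjmx (A - B) = adjmx A - adjmx B.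
Proof. by rewrite /adjmx map_mxB linearB. Qed.

Lemma adjmxZ m n (c : C) (A : 'M[C]_(m, n)) :
  adjmx (c *: A) = conjc c *: adjmx A.
Proof. by rewrite /adjmx map_mxZ linearZ. Qed.

Lemma adjmx_scalar n (c : C) : adjmx (c%:M : 'M[C]_n) = (conjc c)%:M.
Proof. by rewrite /adjmx map_scalar_mx tr_scalar_mx. Qed.

Lemma adjmx_sum m n (I : finType) (F : I -> 'M[C]_(m, n)) :
  adjmx (\sum_i F i) = \sum_i adjmx (F i).
Proof. by rewrite /adjmx map_mx_sum linear_sum. Qed.

Lemma tr_adjmx n (A : 'M[C]_n) : \tr (adjmx A) = conjc (\tr A).
Proof.
by rewrite /adjmx mxtrace_tr /mxtrace rmorph_sum; apply: eq_bigr => i _; rewrite mxE.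
Qed.

Lemma tr_adjmxM m n (A : 'M[C]_(m, n)) :
  \tr (adjmx A *m A) = \sum_j \sum_i `|A i j| ^+ 2.
Proof.
rewrite /mxtrace; apply: eq_bigr => j _; rewrite mxE; apply: eq_bigr => i _.
by rewrite !mxE normCK mulrC.
Qed.

Lemma tr_adjmxM_ge0 m n (A : 'M[C]_(m, n)) : 0 <= \tr (adjmx A *m A).
Proof.
by rewrite tr_adjmxM; do 2![apply: sumr_ge0 => ? _]; rewrite exprn_ge0.
Qed.

Lemma tr_adjmxM_eq0 m n (A : 'M[C]_(m, n)) : \tr (adjmx A *m A) = 0 -> A = 0.
Proof.
rewrite tr_adjmxM => /eqP; rewrite psumr_eq0 => [/allP h|j _]; last first.
  by apply: sumr_ge0 => i _; rewrite exprn_ge0.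
apply/matrixP => i j; have := h j (mem_index_enum _).
rewrite psumr_eq0 => [/allP/(_ i (mem_index_enum _))|? _]; last by rewrite exprn_ge0.
by rewrite expf_eq0 normr_eq0 mxE => /eqP.
Qed.

(** Testing against the adjoint of [A] gives the sum of the squared moduli of its entries. This
    nondegeneracy is what makes a dual map linear. *)
Lemma tr_mulmx_nondeg n (A : 'M[C]_n) :
  (forall B : 'M[C]_n, \tr (A *m B) = 0) -> A = 0.
Proof.
move=> h; rewrite -[A]adjmxK (tr_adjmxM_eq0 (A := adjmx A)) ?adjmxK //.
by rewrite /adjmx map_mx0 trmx0.
Qed.

Definition hermitian n (A : 'M[C]_n) : Prop := adjmx A = A.

(** If [A + adjmx A] vanishes, then [A] is anti-Hermitian and ['i *: A] is Hermitian. Fixed points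
    and eigenvectors can thus be replaced by Hermitian ones whenever the equation also holds for the
    adjoint. *)
Lemma nonzero_hermitian_comb n (A : 'M[C]_n) : A != 0 ->
  exists a b : C, hermitian (a *: A + b *: adjmx A) /\ a *: A + b *: adjmx A != 0.
Proof.
move=> A0; have [z|n1] := eqVneq (A + adjmx A) 0; last first.
  by exists 1, 1; rewrite !scale1r; split=> //; rewrite /hermitian adjmxD adjmxK addrC.
have aA : adjmx A = - A by apply/eqP; rewrite -addr_eq0 addrC z.
exists 'i, 0; rewrite scale0r addr0; split.
  rewrite /hermitian adjmxZ aA scalerN -scaleNr; congr (_ *: _).
  by apply/eqP; rewrite eq_complex /= oppr0 opprK !eqxx.
by rewrite scaler_eq0 negb_or A0 andbT eq_complex /= oner_eq0 andbF.
Qed.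

(** Writing the quadratic form as a trace pairing with a dyad lets trace duality act on
    positivity. *)
Lemma psdE n (A : 'M[C]_n) (x : 'I_n -> C) :
  \sum_i \sum_j (x i)^* * A i j * x j =
  \tr (A *m ((\col_i x i) *m adjmx (\col_i x i))).
Proof.
rewrite mulmxA mxtrace_mulC /mxtrace big_ord1 mxE; apply: eq_bigr => i _.
rewrite !mxE mulr_sumr; apply: eq_bigr => j _.
by rewrite !mxE mulrA.
Qed.

Lemma psdP n (A : 'M[C]_n) :
  psd A <-> forall x : 'cV[C]_n, 0 <= \tr (A *m (x *m adjmx x)).
Proof.
split=> h x; last by rewrite psdE.
have -> : x = \col_i x i 0 by apply/colP => i; rewrite mxE.
by rewrite -psdE; apply: h.
Qed.

Lemma psd_dyad n (x : 'cV[C]_n) : psd (x *m adjmx x).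
Proof.
apply/psdP => y.
rewrite -mulmxA mxtrace_mulC.
have -> : adjmx x *m (y *m adjmx y) *m x = adjmx (adjmx y *m x) *m (adjmx y *m x).
  by rewrite adjmxM adjmxK !mulmxA.
exact: tr_adjmxM_ge0.
Qed.

(* Polarization with the phases 1 and 'i. *)
Lemma qform_eq0 n (B : 'M[C]_n) :
  (forall x : 'cV[C]_n, \tr (B *m (x *m adjmx x)) = 0) -> B = 0.
Proof.
move=> h.
pose b (x y : 'cV[C]_n) := \tr (B *m (x *m adjmx y)).
have bDl x x' y : b (x + x') y = b x y + b x' y.
  by rewrite /b mulmxDl mulmxDr mxtraceD.
have bDr x y y' : b x (y + y') = b x y + b x y'.
  by rewrite /b adjmxD mulmxDr mulmxDr mxtraceD.
have bZl c x y : b (c *: x) y = c * b x y.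
  by rewrite /b -scalemxAl -scalemxAr mxtraceZ.
have bZr c x y : b x (c *: y) = conjc c * b x y.
  by rewrite /b adjmxZ -scalemxAr -scalemxAr mxtraceZ.
have bb x : b x x = 0 by apply: h.
have hb x y c : conjc c * b x y + c * b y x = 0.
  by have := bb (x + c *: y); rewrite bDl !bDr !bZr !bZl !bb !mulr0 add0r addr0.
have b0 x y : b x y = 0.
  have h1 := hb x y 1; have hi := hb x y ('i)%C.
  rewrite rmorph1 !mul1r in h1.
  move/eqP: h1; rewrite addrC addr_eq0 => /eqP h1.
  have hi' : ('i)^* = - 'i :> C by apply/eqP; rewrite eq_complex /= oppr0 !eqxx.
  move: hi; rewrite h1 hi' mulrN mulNr -opprD -mulrDr => /eqP.
  rewrite oppr_eq0 mulf_eq0 eq_complex /= oner_eq0 andbF /=.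
  by rewrite -mulr2n mulrn_eq0 /= => /eqP.
apply/matrixP => i j; have := b0 (delta_mx j 0) (delta_mx i 0).
rewrite /b mulmxA mxtrace_mulC trace_mx11 -colE /adjmx map_delta_mx trmx_delta -rowE !mxE.
by [].
Qed.

(** The quadratic form of the adjoint is the conjugate of that of [A]. A nonnegative number is its
    own conjugate, so the form of the difference vanishes. *)
Lemma psd_hermitian n (A : 'M[C]_n) : psd A -> hermitian A.
Proof.
move/psdP => h; apply/eqP; rewrite -subr_eq0; apply/eqP; apply: qform_eq0 => x.
rewrite mulmxBl linearB /=; apply/eqP; rewrite subr_eq0; apply/eqP.
have hx : adjmx (x *m adjmx x) = x *m adjmx x by rewrite adjmxM adjmxK.
rewrite -{1}hx -adjmxM tr_adjmx mxtrace_mulC.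
by apply/CrealP/ger0_real.
Qed.

End Adjoint.

(** * Spectral decompositions *)

Section Spectral.
Variable R : realType.
Local Notation C := R[i].

Definition spec n (U : 'M[C]_n) (d : 'I_n -> R) : 'M[C]_n :=
  U *m diag_mx (\row_i (d i)%:C) *m adjmx U.

Lemma adjmx_unitary n (U : 'M[C]_n) : Defs.unitarymx U -> adjmx U *m U = 1%:M.
Proof. exact: mulmx1C. Qed.

Lemma adjmx_trmxC m n (A : 'M[C]_(m, n)) : adjmx A = map_mx Num.conj A^T.
Proof. by apply/matrixP => i j; rewrite !mxE. Qed.

(** The spectral theorem for normal matrices puts the inverse of the unitary factor on the left, so
    [U] is the adjoint of [spectralmx A]. The eigenvalues are real, hence equal to their real
    parts. *)
Lemma hermitian_specP n (A : 'M[C]_n) : hermitian A ->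
  exists U d, Defs.unitarymx U /\ A = spec U d.
Proof.
move=> hA.
have hs : A \is hermsymmx.
  by apply/is_hermitianmxP; rewrite expr0 scale1r -adjmx_trmxC hA.
have /orthomx_spectralP -> := hermitian_normalmx hs.
have hU := spectral_unitarymx A.
have hd := hermitian_spectral_diag_real hs.
exists (adjmx (spectralmx A)), (fun i => complex.Re (spectral_diag A 0 i)); split.
  rewrite /Defs.unitarymx adjmxK; apply: mulmx1C.
  by rewrite adjmx_trmxC; apply/unitarymxP.
rewrite /spec adjmxK (invmx_unitary hU) -adjmx_trmxC; congr (_ *m diag_mx _ *m _).
apply/rowP => i; rewrite mxE; move/mxOverP: hd => /(_ 0 i).
move/CrealP/esym; case: (spectral_diag A 0 i) => a b /= [] /eqP.
by rewrite -addr_eq0 -mulr2n mulrn_eq0 /= => /eqP ->.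
Qed.

Lemma hermitian_spec n (U : 'M[C]_n) d : hermitian (spec U d).
Proof.
rewrite /hermitian /spec !adjmxM adjmxK mulmxA; congr (_ *m _ *m _).
rewrite /adjmx map_diag_mx tr_diag_mx; congr diag_mx; apply/rowP => i.
by rewrite !mxE; apply: conjc_real.
Qed.

Lemma specD n (U : 'M[C]_n) d e : spec U d + spec U e = spec U (fun i => d i + e i).
Proof.
rewrite /spec -mulmxDl -mulmxDr -linearD; congr (_ *m diag_mx _ *m _).
by apply/rowP => i; rewrite !mxE rmorphD.
Qed.

Lemma specZ n (U : 'M[C]_n) d (c : R) : c%:C *: spec U d = spec U (fun i => c * d i).
Proof.
rewrite /spec scalemxAl scalemxAr -linearZ; congr (_ *m diag_mx _ *m _).
by apply/rowP => i; rewrite !mxE rmorphM.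
Qed.

Lemma spec_const n (U : 'M[C]_n) (c : R) : Defs.unitarymx U ->
  spec U (fun=> c) = c%:C%:M.
Proof.
move=> hU; rewrite /spec.
have -> : \row_(i < n) c%:C = const_mx c%:C by apply/rowP => i; rewrite !mxE.
by rewrite diag_const_mx mul_mx_scalar -scalemxAl hU scale_scalar_mx mulr1.
Qed.

Lemma specM n (U : 'M[C]_n) d e : Defs.unitarymx U ->
  spec U d *m spec U e = spec U (fun i => d i * e i).
Proof.
move=> hU; rewrite /spec -!mulmxA; congr (_ *m _).
rewrite [adjmx U *m (U *m _)]mulmxA (adjmx_unitary hU) mul1mx mulmxA mulmx_diag.
by congr (diag_mx _ *m _); apply/rowP => i; rewrite !mxE rmorphM.
Qed.

Lemma tr_spec n (U : 'M[C]_n) d : Defs.unitarymx U ->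
  \tr (spec U d) = (\sum_i d i)%:C.
Proof.
move=> hU; rewrite /spec mxtrace_mulC mulmxA (adjmx_unitary hU) mul1mx mxtrace_diag.
by rewrite rmorph_sum; apply: eq_bigr => i _; rewrite mxE.
Qed.

Definition eigproj n (U : 'M[C]_n) i : 'M[C]_n := col i U *m adjmx (col i U).

Lemma psd_eigproj n (U : 'M[C]_n) i : psd (eigproj U i).
Proof. exact: psd_dyad. Qed.

Lemma spec_sum n (U : 'M[C]_n) d : spec U d = \sum_i (d i)%:C *: eigproj U i.
Proof.
apply/matrixP => i j; rewrite /spec mul_mx_diag mxE summxE; apply: eq_bigr => k _.
by rewrite !mxE big_ord1 !mxE mulrA [X in X * _]mulrC.
Qed.

Lemma sum_eigproj n (U : 'M[C]_n) : Defs.unitarymx U -> \sum_i eigproj U i = 1%:M.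
Proof.
move=> /(spec_const 1) <-; rewrite spec_sum.
by apply: eq_bigr => i _; rewrite rmorph1 scale1r.
Qed.

Lemma tr_eigproj n (U : 'M[C]_n) i : Defs.unitarymx U -> \tr (eigproj U i) = 1.
Proof.
move=> /adjmx_unitary /matrixP /(_ i i); rewrite !mxE eqxx => h; apply: etrans h.
rewrite mxtrace_mulC trace_mx11 mxE; apply: eq_bigr => k _.
by rewrite !mxE.
Qed.

Lemma tr_spec_eigproj n (U : 'M[C]_n) d i : Defs.unitarymx U ->
  \tr (spec U d *m eigproj U i) = (d i)%:C.
Proof.
move=> /adjmx_unitary hU.
rewrite /eigproj mulmxA mxtrace_mulC trace_mx11 !colE adjmxM /spec.
rewrite -!mulmxA (mulmxA (adjmx U) U (delta_mx _ _)) hU mul1mx.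
rewrite !mulmxA -(mulmxA _ (adjmx U) U) hU mulmx1.
rewrite /adjmx map_delta_mx trmx_delta -rowE -colE !mxE eqxx.
by [].
Qed.

Lemma psd_specE n (U : 'M[C]_n) d : Defs.unitarymx U ->
  psd (spec U d) <-> forall i, 0 <= d i.
Proof.
move=> hU; split=> [/psdP h i|h].
  by have := h (col i U); rewrite -/(eigproj U i) tr_spec_eigproj // lecR.
apply/psdP => x; rewrite spec_sum mulmx_suml linear_sum; apply: sumr_ge0 => i _ /=.
rewrite -scalemxAl mxtraceZ mulr_ge0 ?ler0c //.
by have /psdP := psd_eigproj U i; apply.
Qed.

(** Expanding [A] into its eigenprojections with nonnegative weights leaves values of the quadratic
    form of [B]. *)
Lemma tr_mul_psd_ge0 n (A B : 'M[C]_n) : psd A -> psd B -> 0 <= \tr (A *m B).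
Proof.
move=> pA /psdP pB; have [U [d [hU eA]]] := hermitian_specP (psd_hermitian pA).
move: pA; rewrite eA => /(psd_specE _ hU) d0.
rewrite spec_sum mulmx_suml linear_sum; apply: sumr_ge0 => i _ /=.
by rewrite -scalemxAl mxtraceZ mulr_ge0 ?ler0c // mxtrace_mulC; apply: pB.
Qed.

(* The overlap matrix of the two eigenbases intertwines d and e entry by entry,
   hence also f \o d and f \o e. *)
Lemma spec_fun n (f : R -> R) (U V : 'M[C]_n) d e :
  Defs.unitarymx U -> Defs.unitarymx V -> spec U d = spec V e ->
  spec U (f \o d) = spec V (f \o e).
Proof.
move=> hU hV /(congr1 (fun M => adjmx V *m M *m U)) h.
pose W := adjmx V *m U.
have tw g k : adjmx V *m spec U g *m U = W *m diag_mx (\row_i (g i)%:C) /\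
    adjmx V *m spec V k *m U = diag_mx (\row_i (k i)%:C) *m W.
  split; rewrite /spec; last by rewrite !mulmxA (adjmx_unitary hV) mul1mx -mulmxA.
  by rewrite -!mulmxA (adjmx_unitary hU) mulmx1 mulmxA.
clearbody W.
have eW : W *m diag_mx (\row_i ((f \o d) i)%:C) = diag_mx (\row_i ((f \o e) i)%:C) *m W.
  move: h; rewrite (tw d e).1 (tw d e).2 => /matrixP h.
  apply/matrixP => i j; have := h i j; rewrite !mul_mx_diag !mul_diag_mx !mxE.
  have [->|W0] := eqVneq (W i j) 0; first by rewrite !mulr0 !mul0r.
  by rewrite mulrC => /(mulIf W0) /complexI /= ->; rewrite mulrC.
rewrite -(tw (f \o d) (f \o e)).1 -(tw (f \o d) (f \o e)).2 in eW.
have VUK X : V *m (adjmx V *m X *m U) *m adjmx U = X.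
  by rewrite !mulmxA hV mul1mx -mulmxA hU mulmx1.
by rewrite -[LHS]VUK eW VUK.
Qed.

(** * Functional calculus, norms and entropy in terms of eigenvalues *)

(** [xget] selects some decomposition of the matrix; by [spec_fun] the result does not depend on
    which one. *)
Lemma mxfun_spec n (f : R -> R) (U : 'M[C]_n) d : Defs.unitarymx U ->
  mxfun f (spec U d) = spec U (f \o d).
Proof.
move=> hU; rewrite /mxfun; case: xgetP => [B _ [V [e [hV eA ->]]]|/(_ (spec U (f \o d)))].
  by symmetry; apply: spec_fun.
by case; exists U, d.
Qed.

Lemma trnorm_spec n (U : 'M[C]_n) d : Defs.unitarymx U ->
  trnorm (spec U d) = \sum_i `|d i|.
Proof.
move=> hU; rewrite /trnorm (hermitian_spec U d) specM // mxfun_spec // tr_spec //=.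
by apply: eq_bigr => i _; rewrite -expr2 sqrtr_sqr.
Qed.

Lemma sqr_hsnorm n (A : 'M[C]_n) : hsnorm A ^+ 2 = complex.Re (\tr (adjmx A *m A)).
Proof.
by rewrite /hsnorm sqr_sqrtr //; have := tr_adjmxM_ge0 A; rewrite lecE => /andP[].
Qed.

Lemma sqr_hsnorm_spec n (U : 'M[C]_n) d : Defs.unitarymx U ->
  hsnorm (spec U d) ^+ 2 = \sum_i d i ^+ 2.
Proof.
by move=> hU; rewrite sqr_hsnorm (hermitian_spec U d) specM // tr_spec.
Qed.

(** Subtracting a scalar shifts the eigenvalues and keeps the eigenbasis. For trace one and
    [c = 1 / n] the right-hand side becomes [hsnorm A ^+ 2 - 1 / n]. *)
Lemma sqr_hsnorm_subscalar n (A : 'M[C]_n) (c : R) : hermitian A ->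
  hsnorm (A - c%:C%:M) ^+ 2 =
    hsnorm A ^+ 2 - 2 * c * complex.Re (\tr A) + n%:R * c ^+ 2.
Proof.
move=> /hermitian_specP[U [d [hU eA]]].
have -> : A - c%:C%:M = spec U (fun i => d i + - c).
  by rewrite eA -specD (spec_const _ hU) !raddfN.
have -> : hsnorm A ^+ 2 = \sum_i d i ^+ 2 by rewrite eA sqr_hsnorm_spec.
have -> : \tr A = (\sum_i d i)%:C by rewrite eA tr_spec.
rewrite (sqr_hsnorm_spec _ hU) /=.
rewrite (eq_bigr (fun i => d i ^+ 2 + (- (2 * c) * d i + c ^+ 2))) => [|i _];
  last by ring.
by rewrite !big_split /= -mulr_sumr sumr_const card_ord -(mulr_natl (c ^+ 2)) addrA mulNr.
Qed.

Lemma entropy_spec n (U : 'M[C]_n) d : Defs.unitarymx U ->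
  entropy (spec U d) = - \sum_i d i * ln (d i).
Proof. by move=> hU; rewrite /entropy mxfun_spec // tr_spec. Qed.

Lemma trnorm_ge0 n (A : 'M[C]_n) : hermitian A -> 0 <= trnorm A.
Proof.
by move=> /hermitian_specP[U [d [hU ->]]]; rewrite trnorm_spec // sumr_ge0.
Qed.

Lemma trnormZ n (c : R) (A : 'M[C]_n) : hermitian A ->
  trnorm (c%:C *: A) = `|c| * trnorm A.
Proof.
move=> /hermitian_specP[U [d [hU ->]]]; rewrite specZ !trnorm_spec // mulr_sumr.
by apply: eq_bigr => i _; rewrite normrM.
Qed.

Lemma hsnorm_ge0 n (A : 'M[C]_n) : 0 <= hsnorm A.
Proof. exact: sqrtr_ge0. Qed.

Lemma hsnorm_eq0 n (A : 'M[C]_n) : hsnorm A = 0 -> A = 0.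
Proof.
move=> h; apply: tr_adjmxM_eq0; have := tr_adjmxM_ge0 A; have := sqr_hsnorm A.
rewrite h expr0n lecE /=; case: (\tr _) => a b /= <- /andP[/eqP -> _].
by [].
Qed.

(** On eigenvalues this is the comparison of the l2 and l1 norms: each squared eigenvalue is at most
    its modulus times the sum of all moduli. *)
Lemma hsnorm_le_trnorm n (A : 'M[C]_n) : hermitian A -> hsnorm A <= trnorm A.
Proof.
move=> hA; rewrite -(ler_pXn2r (n := 2)) ?nnegrE ?hsnorm_ge0 ?trnorm_ge0 //.
have [U [d [hU ->]]] := hermitian_specP hA.
rewrite sqr_hsnorm_spec // trnorm_spec // expr2 mulr_suml; apply: ler_sum => i _.
rewrite -real_normK ?num_real // expr2 ler_wpM2l //.
by rewrite (bigD1 i) //= lerDl sumr_ge0.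
Qed.

Lemma trnorm_eq0 n (A : 'M[C]_n) : hermitian A -> trnorm A <= 0 -> A = 0.
Proof.
move=> hA h; apply: hsnorm_eq0; apply/eqP; rewrite eq_le hsnorm_ge0 andbT.
exact: le_trans (hsnorm_le_trnorm hA) h.
Qed.

End Spectral.

(** * Real inequalities *)

(* By the mean value theorem: the x-derivative of LHS - RHS is
   (ln x - ln y) - (x - y), which on ]0, 1] has the sign of x - y. *)
Lemma bregman_xlnx_ge (R : realType) (x y : R) : 0 <= x <= 1 -> 0 < y <= 1 ->
  (x - y) ^+ 2 / 2 <= x * ln x - x * ln y - x + y.
Proof.
move=> /andP[x0 x1] /andP[y0 y1].
(* At [x = 0], where [ln] has no derivative, the claim reads [y ^+ 2 / 2 <= y]. *)
have [->|xn0] := eqVneq x 0; first by rewrite !mul0r; nra.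
have {xn0}x0 : 0 < x by rewrite lt_neqAle eq_sym xn0.
pose f (t : R) : R := t * ln t - t * ln y - t + y - (t - y) ^+ 2 / 2.
suff : 0 <= f x by rewrite /f subr_ge0.
have fy : f y = 0 by rewrite /f; ring.
pose df (t : R) : R := ln t - ln y - (t - y).
have fd (t : R) : 0 < t -> is_derive t 1 f (df t).
  move=> t0; have lnt := is_derive1_ln t0.
  apply: is_derive_eq; rewrite /df /GRing.scale /=; field; exact: lt0r_neq0.
(* On ]0, 1] the slope of [ln] is at least 1: [ln (a / b) <= a / b - 1], which is at most [a - b]
   because [a <= b <= 1]. *)
have lnD (a b : R) : 0 < a -> a <= b -> b <= 1 -> b - a <= ln b - ln a.
  move=> a0 ab b1; have b0 := lt_le_trans a0 ab.
  have := @le_ln1Dx R (a / b - 1).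
  rewrite (addrC 1) subrK ltrBrDl subrr divr_gt0 // => /(_ isT).
  rewrite ln_div ?posrE // => h.
  have h2 : a / b - 1 <= a - b.
    have -> : a / b - 1 = (a - b) / b by field; exact: lt0r_neq0.
    rewrite ler_pdivrMr //; nra.
  lra.
have fc a b : 0 < a -> ({within `[a, b], continuous f})%classic.
  move=> a0; apply: derivable_within_continuous => t; rewrite in_itv /= => /andP[at_ _].
  by have := fd t (lt_le_trans a0 at_) => -[].
have [xy|yx|->] := ltgtP x y; last by rewrite fy.
- have [c|c] := MVT xy (df := df) _ (fc _ _ x0).
    by rewrite in_itv /= => /andP[xc _]; apply: fd; apply: lt_trans xc.
  rewrite in_itv /= fy => /andP[xc cy] /= h.
  have := lnD c y (lt_trans x0 xc) (ltW cy) y1; rewrite /df in h; nra.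
- have [c|c] := MVT yx (df := df) _ (fc _ _ y0).
    by rewrite in_itv /= => /andP[xc _]; apply: fd; apply: lt_trans xc.
  rewrite in_itv /= fy => /andP[yc cx] /= h.
  have := lnD y c y0 (ltW yc) (le_trans (ltW cx) x1); rewrite /df in h; nra.
Qed.

(* Jensen for -x ln x + x^2 / 2, which is concave on [0, 1]. *)
Lemma stochastic_entropy_ge (R : realType) n (Q : 'I_n -> 'I_n -> R) (d e : 'I_n -> R) :
  (forall i j, 0 <= Q i j) -> (forall i, \sum_j Q i j = 1) ->
  (forall j, \sum_i Q i j = 1) -> (forall i, e i = \sum_j Q i j * d j) ->
  (forall j, 0 <= d j <= 1) ->
  (\sum_j d j ^+ 2 - \sum_i e i ^+ 2) / 2 <=
    \sum_j d j * ln (d j) - \sum_i e i * ln (e i).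
Proof.
move=> Q0 Qr Qc eE d01.
pose g (x : R) := x * ln x - x ^+ 2 / 2.
have key i : g (e i) <= \sum_j Q i j * g (d j).
  have Qd0 j : 0 <= Q i j * d j by rewrite mulr_ge0 //; case/andP: (d01 j).
  have e0 : 0 <= e i by rewrite eE sumr_ge0.
  have e1 : e i <= 1.
    by rewrite eE -(Qr i) ler_sum // => j _; rewrite ler_piMr //; case/andP: (d01 j).
  (* There is no tangent to [g] at 0. If the average [e i] is 0, every term [Q i j * d j] vanishes,
     and both sides are 0 since [g x] has a factor [x]. *)
  have [ei0|en0] := eqVneq (e i) 0.
    have z j : Q i j * d j = 0.
      move/eqP: ei0; rewrite eE psumr_eq0 // => /allP /(_ j (mem_index_enum _)).
      by move/eqP.
    have gE x : g x = x * (ln x - x / 2) by rewrite /g; ring.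
    by rewrite gE ei0 mul0r big1 // => j _; rewrite gE mulrA z mul0r.
  have ep : 0 < e i <= 1 by rewrite e1 lt_neqAle eq_sym en0 e0.
  have avg a b : a = \sum_j Q i j * (a + b * (d j - e i)).
    rewrite (eq_bigr (fun j => a * Q i j +
               (b * (Q i j * d j) - b * e i * Q i j))) => [|j _].
      by rewrite big_split /= sumrB -!mulr_sumr Qr -eE; ring.
    by ring.
  (* The slope [ln (e i) + 1 - e i] is the derivative of [g] at [e i]. The tangent line there
     averages to [g (e i)], and [bregman_xlnx_ge] places [g] above it. *)
  rewrite (avg (g (e i)) (ln (e i) + 1 - e i)).
  apply: ler_sum => j _; apply: ler_wpM2l => //.
  have := bregman_xlnx_ge (d01 j) ep; rewrite /g; nra.
have : \sum_i g (e i) <= \sum_j g (d j).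
  apply: le_trans (ler_sum _ (fun i _ => key i)) _.
  rewrite exchange_big /=; apply: ler_sum => j _.
  by rewrite -mulr_suml Qc mul1r.
rewrite /g !sumrB -!mulr_suml; lra.
Qed.

Lemma stochastic_sum_norm_le (R : realType) n (Q : 'I_n -> 'I_n -> R) (d e : 'I_n -> R) :
  (forall i j, 0 <= Q i j) -> (forall j, \sum_i Q i j = 1) ->
  (forall i, e i = \sum_j Q i j * d j) -> \sum_i `|e i| <= \sum_j `|d j|.
Proof.
move=> Q0 Qc eE.
have key i : `|e i| <= \sum_j Q i j * `|d j|.
  rewrite eE; apply: le_trans (ler_norm_sum _ _ _) _.
  by apply: ler_sum => j _; rewrite normrM ger0_norm.
apply: le_trans (ler_sum _ (fun i _ => key i)) _.
by rewrite exchange_big /=; apply: ler_sum => j _; rewrite -mulr_suml Qc mul1r.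
Qed.

(* Log-convexity makes the ratios c_(m+1) / c_m nondecreasing, so c grows at
   least geometrically with ratio c_1 / c_0. *)
Lemma logconvex_geometric_le (R : realType) (c : nat -> R) (q M : R) :
  0 <= q -> (forall m, 0 <= c m) -> (forall m, c m.+1 ^+ 2 <= c m * c m.+2) ->
  (forall m, c m <= q ^+ m * M) -> c 1%N <= q * c 0%N.
Proof.
move=> q0 c0 lc cM; rewrite leNgt; apply/negP => lt1.
have c1p : 0 < c 1%N by apply: le_lt_trans lt1; rewrite mulr_ge0.
have c0p : 0 < c 0%N.
  rewrite lt_neqAle c0 andbT eq_sym; apply/negP => /eqP z.
  by have := lc 0%N; rewrite z mul0r leNgt exprn_gt0.
pose r := c 1%N / c 0%N.
have r0 : 0 < r by rewrite divr_gt0.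
(* Positivity is carried through the induction so that [c m] can be cancelled in the log-convexity
   inequality. *)
have step m : 0 < c m /\ r * c m <= c m.+1.
  elim: m => [|m [cmp rm]]; first by split=> //; rewrite /r mulfVK ?gt_eqF.
  have cm1 : 0 < c m.+1 by apply: lt_le_trans rm; rewrite mulr_gt0.
  split=> //; rewrite -(ler_pM2l cmp); apply: le_trans (lc m).
  by rewrite mulrCA mulrA expr2 ler_wpM2r // ltW.
have geo m : r ^+ m * c 0%N <= c m.
  elim: m => [|m ih]; first by rewrite expr0 mul1r.
  by rewrite exprS -mulrA; apply: le_trans (step m).2; rewrite ler_wpM2l // ltW.
have qr : q < r by rewrite /r ltr_pdivlMr.
have M0 : 0 < M by have := cM 0%N; rewrite expr0 mul1r; apply: lt_le_trans.
have [q00|qn0] := eqVneq q 0.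
  by have := cM 1%N; rewrite q00 expr1 mul0r leNgt c1p.
have qp : 0 < q by rewrite lt_neqAle eq_sym qn0.
(* The power [(r / q) ^+ m] is at least the linear expression by Bernoulli's inequality, and at most
   [M / c 0] by [geo] and [cM]. *)
have bnd m : 1 + (r / q - 1) *+ m <= M / c 0%N.
  have p0 : 0 <= r / q - 1 by rewrite subr_ge0 ler_pdivlMr // mul1r ltW.
  apply: le_trans (_ : (r / q) ^+ m <= _).
    elim: m => [|m ih]; first by rewrite mulr0n addr0 expr0.
    rewrite exprS mulrS.
    have : 0 <= (r / q - 1) *+ m by rewrite mulrn_wge0.
    move: ih p0; set a := r / q; set b := (a - 1) *+ m; set z := a ^+ m => ih p0 b0.
    nra.
  rewrite ler_pdivlMr // expr_div_n mulrAC ler_pdivrMr ?exprn_gt0 //.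
  by rewrite [M * _]mulrC; apply: le_trans (cM m).
have p0 : 0 < r / q - 1 by rewrite subr_gt0 ltr_pdivlMr // mul1r.
(* This index exceeds [M / c 0] divided by the slope [r / q - 1], so the linear lower bound
   overtakes its constant upper bound. *)
have h := bnd (Num.truncn (M / c 0%N / (r / q - 1))).+1.
have : M / c 0%N / (r / q - 1) < (Num.truncn (M / c 0%N / (r / q - 1))).+1%:R.
  by rewrite truncnS_gt.
rewrite ltr_pdivrMr // mulr_natl => h2.
by have := lt_le_trans h2 (le_trans _ h); rewrite ltxx lerDr ler01 => /(_ isT).
Qed.

(** * Bistochastic positive maps *)

Section BistochasticMaps.
Variables (R : realType) (n : nat).
Local Notation C := R[i].

(** Trace preservation stands for unitality of the dual, so the notion applies equally to a channel
    and to its dual. *)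
Definition bistochastic_map (F : 'M[C]_n -> 'M[C]_n) : Prop :=
  [/\ forall A, psd A -> psd (F A), F 1%:M = 1%:M & forall A, \tr (F A) = \tr A].

(** This is the case [k = 1] of complete positivity; the work lies in identifying sums over
    ['I_1 * 'I_n] with sums over ['I_n]. *)
Lemma cp_positive (F : 'M[C]_n -> 'M[C]_n) A :
  completely_positive F -> psd A -> psd (F A).
Proof.
move=> cpF pA x.
have pB : psdf (fun p q : 'I_1 * 'I_n => A p.2 q.2).
  move=> y; rewrite (_ : \sum_i _ = \sum_i \sum_j (y (ord0, i))^* * A i j * y (ord0, j)).
    exact: (pA (fun i => y (ord0, i))).
  rewrite (eq_bigr (fun p => \sum_j (y (p.1, p.2))^* * A p.2 j * y (ord0, j))) => [|p _].
    rewrite -(pair_bigA _ (fun a i => \sum_j (y (a, i))^* * A i j * y (ord0, j))).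
    by rewrite big_ord1.
  rewrite (eq_bigr (fun q => (y (p.1, p.2))^* * A p.2 q.2 * y (q.1, q.2))) => [|[] //].
    by rewrite -(pair_bigA _ (fun a j => (y (p.1, p.2))^* * A p.2 j * y (a, j))) big_ord1.
  by case: p.
have := cpF 1%N _ pB (fun p => x p.2).
have eA : \matrix_(i, j) A i j = A by apply/matrixP => i j; rewrite mxE.
rewrite /= eA.
congr (_ <= _).
rewrite -(pair_bigA _ (fun a i =>
  \sum_(q : 'I_1 * 'I_n) (x i)^* * F A i q.2 * x q.2)) big_ord1.
apply: eq_bigr => i _.
by rewrite -(pair_bigA _ (fun a j => (x i)^* * F A i j * x j)) big_ord1.
Qed.

(** A Hermitian matrix is a real combination of eigenprojections, whose images are positive
    semidefinite and therefore Hermitian. *)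
Lemma positive_hermitian (F : {linear 'M[C]_n -> 'M[C]_n}) A :
  (forall A, psd A -> psd (F A)) -> hermitian A -> hermitian (F A).
Proof.
move=> pF /hermitian_specP[U [d [_ ->]]].
rewrite spec_sum linear_sum /hermitian adjmx_sum; apply: eq_bigr => i _.
rewrite linearZ adjmxZ conjc_real; congr (_ *: _).
by apply: psd_hermitian; apply: pF; apply: psd_eigproj.
Qed.

(** Both [A + adjmx A] and ['i *: (A - adjmx A)] are Hermitian and so have Hermitian images; adding
    and subtracting the two resulting identities isolates the image of the adjoint. *)
Lemma positive_adjmx (F : {linear 'M[C]_n -> 'M[C]_n}) A :
  (forall A, psd A -> psd (F A)) -> F (adjmx A) = adjmx (F A).
Proof.
move=> pF.
have h1 : hermitian (A + adjmx A) by rewrite /hermitian adjmxD adjmxK addrC.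
have h2 : hermitian ('i *: (A - adjmx A)).
  rewrite /hermitian adjmxZ adjmxB adjmxK -opprB scalerN -scaleNr; congr (_ *: _).
  by apply/eqP; rewrite eq_complex /= oppr0 opprK !eqxx.
have := positive_hermitian pF h2; have := positive_hermitian pF h1.
rewrite /hermitian !(linearD, linearZ, linearN) /= adjmxD adjmxZ adjmxB => e1.
rewrite (_ : conjc 'i = - 'i); last by apply/eqP; rewrite eq_complex /= oppr0 !eqxx.
rewrite scaleNr -scalerN => /(scalerI _) e2.
have {}e2 : - (adjmx (F A) - adjmx (F (adjmx A))) = F A - F (adjmx A).
  by apply: e2; rewrite eq_complex /= oner_eq0 andbF.
apply: (@scalerI _ _ (2%:R : C)); first by rewrite pnatr_eq0.
move: e1 e2; set a := adjmx (F A); set b := adjmx (F (adjmx A)).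
rewrite opprB !scaler_nat !mulr2n => e1 e2.
have DB (x y : 'M[C]_n) : y + y = (x + y) - (x - y).
  by rewrite opprB [RHS]addrC addrA subrK.
by rewrite (DB (F A)) -e1 -e2 (addrC a) -DB.
Qed.

(** Positivity gives nonnegative entries. Since eigenprojections sum to the identity, unitality
    gives the row sums and trace preservation the column sums. *)
Lemma bistochastic_eigenvalues (F : {linear 'M[C]_n -> 'M[C]_n}) U V d e :
  bistochastic_map F -> Defs.unitarymx U -> Defs.unitarymx V ->
  F (spec V d) = spec U e ->
  exists Q : 'I_n -> 'I_n -> R,
    [/\ forall i j, 0 <= Q i j, forall i, \sum_j Q i j = 1,
        forall j, \sum_i Q i j = 1 & forall i, e i = \sum_j Q i j * d j].
Proof.
move=> [pF F1 Ft] hU hV Fde.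
pose q i j := \tr (F (eigproj V j) *m eigproj U i).
have q0 i j : 0 <= q i j.
  by apply: tr_mul_psd_ge0; [apply: pF|]; apply: psd_eigproj.
have qE i j : q i j = (complex.Re (q i j))%:C.
  by have := ger0_Im (q0 i j); case: (q i j) => a b /= ->.
exists (fun i j => complex.Re (q i j)); split=> [i j|i|j|i].
- by have := q0 i j; rewrite lecE => /andP[].
- apply: complexI; rewrite rmorph_sum rmorph1 /=.
  under eq_bigr do rewrite -qE.
  rewrite /q -linear_sum -mulmx_suml -linear_sum sum_eigproj // F1 mul1mx.
  exact: tr_eigproj.
- apply: complexI; rewrite rmorph_sum rmorph1 /=.
  under eq_bigr do rewrite -qE.
  rewrite /q -linear_sum -mulmx_sumr sum_eigproj // mulmx1 /= Ft.
  exact: tr_eigproj.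
- apply: complexI; rewrite rmorph_sum /= -(tr_spec_eigproj e i hU) -Fde spec_sum.
  rewrite linear_sum mulmx_suml linear_sum; apply: eq_bigr => j _ /=.
  by rewrite linearZ -scalemxAl mxtraceZ -/(q i j) rmorphM /= -qE mulrC.
Qed.

Lemma bistochastic_trnorm_le (F : {linear 'M[C]_n -> 'M[C]_n}) A :
  bistochastic_map F -> hermitian A -> trnorm (F A) <= trnorm A.
Proof.
move=> bF hA; have pF := let: And3 p _ _ := bF in p.
have [U [e [hU eFA]]] := hermitian_specP (positive_hermitian pF hA).
have [V [d [hV eA]]] := hermitian_specP hA.
have [|Q [Q0 _ Qc eQ]] := @bistochastic_eigenvalues F U V d e bF hU hV.
  by rewrite -eA.
rewrite eFA eA !trnorm_spec //; exact: stochastic_sum_norm_le eQ.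
Qed.

Lemma bistochastic_entropy_ge (F : {linear 'M[C]_n -> 'M[C]_n}) s :
  bistochastic_map F -> density s ->
  (hsnorm s ^+ 2 - hsnorm (F s) ^+ 2) / 2 <= entropy (F s) - entropy s.
Proof.
move=> bF [ps ts]; have pF := let: And3 p _ _ := bF in p.
have hs := psd_hermitian ps.
have [U [e [hU eFs]]] := hermitian_specP (positive_hermitian pF hs).
have [V [d [hV es]]] := hermitian_specP hs.
have [|Q [Q0 Qr Qc eQ]] := @bistochastic_eigenvalues F U V d e bF hU hV.
  by rewrite -es.
have := (sqr_hsnorm_spec e hU, entropy_spec e hU); rewrite -eFs => -[-> ->].
have := (sqr_hsnorm_spec d hV, entropy_spec d hV); rewrite -es => -[-> ->].
rewrite opprK [leRHS]addrC.
apply: stochastic_entropy_ge eQ _ => // j.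
move: ps ts; rewrite es tr_spec // => /(psd_specE _ hV) d0.
move=> /(congr1 (@complex.Re R)) /= d1.
by rewrite d0 -d1 (bigD1 j) //= lerDl sumr_ge0.
Qed.

(** With [a] and [b] the norms of [A] and [B] and [t] their real inner product, the squared norm of
    [b A - a B] equals [2 * a * b * (a * b - t)]. The cases of zero norm come first so that
    [2 * a * b] can be cancelled. *)
Lemma Re_tr_cauchy_schwarz (A B : 'M[C]_n) :
  complex.Re (\tr (adjmx A *m B)) <= hsnorm A * hsnorm B.
Proof.
have [a0|an0] := eqVneq (hsnorm A) 0.
  by rewrite a0 (hsnorm_eq0 a0) /adjmx map_mx0 trmx0 mul0mx linear0 mul0r.
have [b0|bn0] := eqVneq (hsnorm B) 0.
  by rewrite b0 (hsnorm_eq0 b0) mulmx0 linear0 mulr0.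
have ap : 0 < hsnorm A by rewrite lt_neqAle eq_sym an0 hsnorm_ge0.
have bp : 0 < hsnorm B by rewrite lt_neqAle eq_sym bn0 hsnorm_ge0.
pose ip (X Y : 'M[C]_n) := complex.Re (\tr (adjmx X *m Y)).
have ReD (y z : C) : complex.Re (y + z) = complex.Re y + complex.Re z.
  by case: y; case: z.
have ipC X Y : ip X Y = ip Y X.
  by rewrite /ip -[in LHS](adjmxK Y) -adjmxM tr_adjmx; case: (\tr _).
have ipD X Y Z : ip X (Y + Z) = ip X Y + ip X Z by rewrite /ip mulmxDr mxtraceD ReD.
have ipZ X (c : R) Y : ip X (c%:C *: Y) = c * ip X Y.
  by rewrite /ip -scalemxAr mxtraceZ; case: (\tr _) => x y /=; rewrite mul0r subr0.
have ipE X : ip X X = hsnorm X ^+ 2 by rewrite sqr_hsnorm.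
rewrite -/(ip A B).
have : 0 <= ip ((hsnorm B)%:C *: A + (- hsnorm A)%:C *: B)
              ((hsnorm B)%:C *: A + (- hsnorm A)%:C *: B) by rewrite ipE sqr_ge0.
rewrite ipD !ipZ !(ipC (_ + _)) !ipD !ipZ (ipC B A) !ipE.
move: ap bp; set a := hsnorm A; set b := hsnorm B; set t := ip A B => ap bp.
have -> : b * (b * a ^+ 2 + - a * t) + - a * (b * t + - a * b ^+ 2) =
          (2 * a * b) * (a * b - t) by ring.
by rewrite pmulr_rge0 ?subr_ge0 // !mulr_gt0.
Qed.

End BistochasticMaps.

(** * A bistochastic map and its dual *)

Section DualChannels.
Variables (R : realType) (n : nat).
Local Notation C := R[i].
Variables T Th : {linear 'M[C]_n -> 'M[C]_n}.
Hypothesis dualT : forall A B, \tr (Th A *m B) = \tr (A *m T B).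

Lemma dual_positive : (forall A, psd A -> psd (T A)) -> forall A, psd A -> psd (Th A).
Proof.
move=> pT A pA; apply/psdP => x; rewrite dualT; apply: tr_mul_psd_ge0 => //.
by apply: pT; apply: psd_dyad.
Qed.

Lemma dual_trace : T 1%:M = 1%:M -> forall A, \tr (Th A) = \tr A.
Proof. by move=> T1 A; have := dualT A 1%:M; rewrite T1 !mulmx1. Qed.

Lemma predual_trace : Th 1%:M = 1%:M -> forall A, \tr (T A) = \tr A.
Proof. by move=> T1 A; have := dualT 1%:M A; rewrite T1 !mul1mx. Qed.

Hypothesis bisT : bistochastic_map T.
Hypothesis bisTh : bistochastic_map Th.
Variable q : R.
Hypothesis q0 : 0 <= q.
Hypothesis contrTh : forall A, hermitian A -> \tr A = 0 -> trnorm (Th A) <= q * trnorm A.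

Let pT : forall A, psd A -> psd (T A). Proof. by case: bisT. Qed.
Let pTh : forall A, psd A -> psd (Th A). Proof. by case: bisTh. Qed.

Lemma tr_adjmx_dual A B : \tr (adjmx (Th A) *m Th B) = \tr (adjmx A *m T (Th B)).
Proof. by rewrite -(positive_adjmx _ pTh) dualT. Qed.

(** Self-adjointness of [T \o Th]: both sides equal the inner product of [Th A] with [Th B]. *)
Lemma tr_adjmx_dualC A B :
  \tr (adjmx (T (Th A)) *m B) = \tr (adjmx A *m T (Th B)).
Proof.
rewrite -tr_adjmx_dual -[LHS]conjcK -tr_adjmx adjmxM adjmxK -tr_adjmx_dual.
by rewrite -tr_adjmx adjmxM adjmxK.
Qed.

(** Comparing the two norms only once would cost a constant depending on [A]; using all iterates at
    once makes that constant harmless, since only the geometric rate survives. *)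
Lemma dual_traceless_hs_contraction A : hermitian A -> \tr A = 0 ->
  hsnorm (Th A) ^+ 2 <= q * hsnorm A ^+ 2.
Proof.
move=> hA tA.
pose K X := T (Th X).
pose X m := iter m K A.
have hX m : [/\ hermitian (X m), \tr (X m) = 0 & trnorm (X m) <= q ^+ m * trnorm A].
  elim: m => [|m [h t le]]; first by rewrite expr0 mul1r.
  have hTh : hermitian (Th (X m)) by apply: positive_hermitian.
  split; first exact: positive_hermitian.
    by case: bisT => _ _ ->; case: bisTh => _ _ ->.
  apply: le_trans (bistochastic_trnorm_le bisT hTh) _.
  by apply: le_trans (contrTh h t) _; rewrite exprS -mulrA ler_wpM2l.
(* Self-adjointness of [K] turns the squared norm of [X m.+1] into the inner product of [X m] with
   [X m.+2]. *)
have lc m : hsnorm (X m.+1) ^+ 2 <= hsnorm (X m) * hsnorm (X m.+2).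
  apply: le_trans (Re_tr_cauchy_schwarz _ _).
  by rewrite sqr_hsnorm /= tr_adjmx_dualC.
have := @logconvex_geometric_le R (fun m => hsnorm (X m)) q (trnorm A) q0
  (fun m => hsnorm_ge0 _) lc.
have b m : hsnorm (X m) <= q ^+ m * trnorm A.
  by have [h _ le] := hX m; apply: le_trans le; apply: hsnorm_le_trnorm.
move=> /(_ b) /= le1.
rewrite sqr_hsnorm tr_adjmx_dual; apply: le_trans (Re_tr_cauchy_schwarz _ _) _.
by rewrite [q * _]mulrC expr2 -mulrA ler_wpM2l ?hsnorm_ge0 // mulrC.
Qed.

(** A nonzero fixed point would yield a nonzero Hermitian one, whose trace norm would be at most
    [q < 1] times itself. *)
Lemma dual_traceless_fixpoint A : q < 1 -> \tr A = 0 -> Th A = A -> A = 0.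
Proof.
move=> q1 tA eA; apply/eqP; apply/negPn/negP => A0.
have [a [b [hX /eqP X0]]] := nonzero_hermitian_comb A0; set X := _ + _ in hX X0.
have tX : \tr X = 0 by rewrite mxtraceD !mxtraceZ tr_adjmx tA conjc0 !mulr0 addr0.
have eX : Th X = X by rewrite /X linearD !linearZ /= (positive_adjmx _ pTh) eA.
apply: X0; apply: trnorm_eq0 => //.
have := contrTh hX tX; have := trnorm_ge0 hX; rewrite eX; nra.
Qed.

(** The Rayleigh quotient of [T \o Th] at [A] is a ratio of squared norms, so [lambda] is
    nonnegative. Being real, it is also the eigenvalue for [adjmx A], which supplies a Hermitian
    eigenvector where the contraction bound applies. *)
Lemma dual_eigenvalue lambda A : A != 0 -> \tr A = 0 -> T (Th A) = lambda *: A ->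
  0 <= lambda <= q%:C.
Proof.
move=> A0 tA eA.
have np (X : 'M[C]_n) : X != 0 -> 0 < \tr (adjmx X *m X).
  move=> Xn0; rewrite lt_neqAle tr_adjmxM_ge0 andbT eq_sym.
  by apply: contraNneq Xn0 => /tr_adjmxM_eq0 ->.
have rayleigh X : T (Th X) = lambda *: X ->
    \tr (adjmx (Th X) *m Th X) = lambda * \tr (adjmx X *m X).
  by move=> eX; rewrite tr_adjmx_dual eX -scalemxAr mxtraceZ.
have l0 : 0 <= lambda.
  have := tr_adjmxM_ge0 (Th A); rewrite rayleigh // pmulr_lge0 //; exact: np.
rewrite l0 /=.
have lE : lambda = (complex.Re lambda)%:C.
  by have := ger0_Im l0; case: (lambda) => a b /= ->.
have eA' : T (Th (adjmx A)) = lambda *: adjmx A.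
  by rewrite (positive_adjmx _ pTh) (positive_adjmx _ pT) eA adjmxZ lE conjc_real.
have [a [b [hX X0]]] := nonzero_hermitian_comb A0; set X := _ + _ in hX X0.
have tX : \tr X = 0 by rewrite mxtraceD !mxtraceZ tr_adjmx tA conjc0 !mulr0 addr0.
have eX : T (Th X) = lambda *: X.
  by rewrite /X scalerDr !scalerA !(mulrC lambda) -!scalerA -eA -eA' !linearD !linearZ.
have := dual_traceless_hs_contraction hX tX; rewrite !sqr_hsnorm rayleigh // lE.
have := np _ X0; rewrite ltcE; case: (\tr _) => u v /= /andP[/eqP -> u0].
by rewrite mul0r subr0 ler_pM2r // lecR.
Qed.

End DualChannels.

(** * From the stated hypotheses to linear maps and traceless matrices *)

Lemma dual_map_linear (R : realType) n (T : {linear 'M[R[i]]_n -> 'M[R[i]]_n})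
    (Th : 'M[R[i]]_n -> 'M[R[i]]_n) :
  (forall A B, \tr (Th A *m B) = \tr (A *m T B)) ->
  exists F : {linear 'M[R[i]]_n -> 'M[R[i]]_n}, Th = F.
Proof.
move=> dualT.
suff linTh : linear Th.
  pose F : {linear 'M[R[i]]_n -> 'M[R[i]]_n} :=
    HB.pack Th (GRing.isLinear.Build _ _ _ _ Th linTh).
  by exists F.
move=> c A B; apply/eqP; rewrite -subr_eq0; apply/eqP; apply: tr_mulmx_nondeg => X.
rewrite mulmxBl mulmxDl -scalemxAl linearB linearD linearZ /= !dualT.
by rewrite mulmxDl -scalemxAl linearD linearZ subrr.
Qed.

(* Rescaling a traceless Hermitian perturbation puts it within the densities
   around the maximally mixed state. *)
Lemma density_contraction_traceless (R : realType) n
    (F : {linear 'M[R[i]]_n -> 'M[R[i]]_n}) (q : R) A :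
  (0 < n)%N -> (forall A, psd A -> psd (F A)) ->
  (forall s s', density s -> density s' -> trnorm (F s - F s') <= q * trnorm (s - s')) ->
  hermitian A -> \tr A = 0 -> trnorm (F A) <= q * trnorm A.
Proof.
move=> n0 pF contr hA tA.
have [U [d [hU eA]]] := hermitian_specP hA.
have dn (g : 'I_n -> R) : (forall i, 0 <= g i) -> \sum_i g i = 1 -> density (spec U g).
  by move=> g0 g1; split; [apply/psd_specE|rewrite tr_spec // g1 rmorph1].
pose S := 1 + trnorm A.
have S0 : 0 < S by rewrite ltr_pwDl // trnorm_ge0.
have dS i : `|d i| <= S.
  by rewrite /S eA trnorm_spec // (bigD1 i) //= addrCA lerDl addr_ge0 // sumr_ge0 //.
(* As [S] bounds every [d i] in modulus, [c] keeps each [c * d i] within 1/n of 0. The summand 1 in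
   [S] keeps it positive even for [A = 0]. *)
clearbody S; pose c := (n%:R * S)^-1.
have nR : 0 < n%:R :> R by rewrite ltr0n.
have c0 : 0 < c by rewrite invr_gt0 mulr_gt0.
have d0 : \sum_i d i = 0 by move: tA; rewrite eA tr_spec // => /(congr1 (@complex.Re R)).
have sn : \sum_(i < n) (n%:R^-1 : R) = 1.
  by rewrite sumr_const card_ord -(mulr_natr n%:R^-1) mulVf ?gt_eqF.
have := contr (spec U (fun i => n%:R^-1 + c * d i)) (spec U (fun=> n%:R^-1)).
rewrite -linearB /=.
have -> : spec U (fun i => n%:R^-1 + c * d i) - spec U (fun=> n%:R^-1) = c%:C *: A.
  by rewrite -specD addrAC subrr add0r -specZ -eA.
rewrite linearZ /= !trnormZ //; last exact: positive_hermitian.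
rewrite gtr0_norm // mulrCA ler_pM2l //; apply.
  apply: dn => [i|]; last by rewrite big_split /= sn -mulr_sumr d0 mulr0 addr0.
  have -> : n%:R^-1 = c * S by rewrite /c invfM mulfVK ?gt_eqF.
  rewrite -mulrDr mulr_ge0 ?(ltW c0) //; have := dS i.
  by rewrite ler_norml -lerBlDl sub0r => /andP[].
by apply: dn => // i; rewrite invr_ge0 ltW.
Qed.

(** * Ergodicity, spectrum and entropy production of the channel *)

Unset Implicit Arguments.
Theorem theorem2 (R : realType) (N : nat) (hN : (2 <= N)%N)
  (T : {linear 'M[R[i]]_N -> 'M[R[i]]_N})
  (Th : 'M[R[i]]_N -> 'M[R[i]]_N)
  (hdual : forall A B : 'M[R[i]]_N, \tr (Th A *m B) = \tr (A *m T B))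
  (hCP : completely_positive T)
  (hT1 : T 1%:M = 1%:M) (hTh1 : Th 1%:M = 1%:M)
  (C : R) (hC0 : 0 <= C) (hC1 : C < 1)
  (hcontr : forall s s' : 'M[R[i]]_N, density s -> density s' ->
     trnorm (Th s - Th s') <= C * trnorm (s - s')) :
  (* (i) ergodicity *)
  (forall X : 'M[R[i]]_N, Th X = X <-> exists chi : R[i], X = chi%:M)
  (* (ii) spectrum of T \o Th in [0, 1 - gamma] \cup {1}, gamma >= 1 - C *)
  /\ (exists gamma : R, 1 - C <= gamma /\
        forall (lambda : R[i]) (X : 'M[R[i]]_N), X != 0 ->
          T (Th X) = lambda *: X ->
          lambda = 1 \/ (0 <= lambda /\ lambda <= (1 - gamma)%:C))
  (* (iii) entropy production bound *)
  /\ (forall s : 'M[R[i]]_N, density s ->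
        (1 - C) / 2 * hsnorm (s - (N%:R)^-1 *: 1%:M) ^+ 2
          <= entropy (Th s) - entropy s).
Proof.
have n0 : (0 < N)%N by apply: leq_trans hN.
have nR : 0 < N%:R :> R by rewrite ltr0n.
have [Tl eTl] := dual_map_linear hdual; subst Th.
have pT A : psd A -> psd (T A) by apply: cp_positive.
have pTh := dual_positive hdual pT.
have bisT : bistochastic_map T by split=> //; apply: (predual_trace hdual).
have bisTh : bistochastic_map Tl by split=> //; apply: (dual_trace hdual).
have contr := density_contraction_traceless n0 pTh hcontr.
have trTl A : \tr (Tl A) = \tr A by case: bisTh.
(* Projection onto the traceless matrices along the scalar ones, which [Tl] fixes. *)
pose E (X : 'M[R[i]]_N) := X - (\tr X / N%:R)%:M.
have trE X : \tr (E X) = 0.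
  rewrite /E linearB /= mxtrace_scalar -(mulr_natr (_ / _)) mulfVK ?subrr //.
  by rewrite pnatr_eq0 -lt0n.
have Tl1 c : Tl c%:M = c%:M by rewrite -scalemx1 linearZ /= hTh1.
split; last split.
- move=> X; split=> [|[c ->]]; last by rewrite Tl1.
  move=> eX; exists (\tr X / N%:R); apply/eqP; rewrite -subr_eq0 -/(E X); apply/eqP.
  apply: (dual_traceless_fixpoint bisTh contr hC1 (trE X)).
  by rewrite linearB /= Tl1 eX.
- exists (1 - C); split=> // lambda X X0 eX.
  have [l1|l1] := eqVneq lambda 1; [by left|right].
  (* Both maps preserve the trace, so the eigenvalue equation forces [(1 - lambda) * \tr X = 0]. *)
  have tX : \tr X = 0.
    have := congr1 mxtrace eX; rewrite mxtraceZ; case: bisT => _ _ ->; rewrite trTl.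
    move/eqP; rewrite eq_sym -subr_eq0 -{2}[\tr X]mul1r -mulrBl mulf_eq0 subr_eq0.
    by rewrite (negPf l1) => /eqP.
  rewrite opprB addrCA subrr addr0; apply/andP.
  exact: (dual_eigenvalue hdual bisT bisTh hC0 contr X0 tX eX).
- move=> s [ps ts].
  have hs := psd_hermitian ps.
  set s0 : 'M[R[i]]_N := _ *: 1%:M.
  have es0 : s0 = (N%:R^-1 : R)%:C%:M.
    by rewrite /s0 scalemx1 fmorphV /= rmorph_nat.
  have hs0 : hermitian s0.
    by rewrite es0 /hermitian adjmx_scalar conjc_real.
  have hsB A : hermitian A -> \tr A = 1 -> hsnorm (A - s0) ^+ 2 = hsnorm A ^+ 2 - N%:R^-1.
    move=> hA tA; rewrite es0 sqr_hsnorm_subscalar // tA /=; field.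
    exact: lt0r_neq0.
  have tl0 : Tl (s - s0) = Tl s - s0 by rewrite linearB /= es0 Tl1.
  have e1 := bistochastic_entropy_ge bisTh (conj ps ts).
  have t0 : \tr (s - s0) = 0.
    by have := trE s; rewrite /E ts div1r /s0 scalemx1.
  have hss0 : hermitian (s - s0) by rewrite /hermitian adjmxB hs hs0.
  (* The shift by [s0] lowers the squared norms of [s] and [Tl s] by the same 1/N, so their
     difference is that of the shifted matrices and is at least [1 - C] times the squared norm of
     [s - s0]. *)
  have := dual_traceless_hs_contraction hdual bisT bisTh hC0 contr hss0 t0.
  have hTs := hsB _ (positive_hermitian pTh hs) (etrans (trTl s) ts).
  have {}hs := hsB _ hs ts.
  rewrite tl0 hTs {}hs; move: e1; lra.
Qed.
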